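(* Let $A, B \in M_n(\mathbb{FT})$. Then $A \mathrel{\mathcal{J}} B$ if and only if $A \mathrel{\mathcal{D}} B$, where $\mathcal{J}$ and $\mathcal{D}$ are Green's relations in the semigroup $M_n(\mathbb{FT})$.
   Context: $\mathbb{FT}$ (finitary tropical semiring) is the set $\mathbb{R}$ with $a \oplus b = \max(a,b)$ and $a \otimes b = a+b$ (ordinary sum). $M_n(\mathbb{FT})$ is the semigroup of $n \times n$ matrices over $\mathbb{FT}$ under matrix multiplication induced from these operations, i.e. $(AB)_{ij} = \max_k (A_{ik} + B_{kj})$. For a semigroup $M$, let $M^1 = M$ if $M$ is a monoid and otherwise $M^1$ is $M$ with an identity adjoined. Green's relations on $M$: $a \mathrel{\mathcal{R}} b$ iff $aM^1 = bM^1$; $a \mathrel{\mathcal{L}} b$ iff $M^1 a = M^1 b$; $a \mathrel{\mathcal{J}} b$ iff $M^1 a M^1 = M^1 b M^1$; $a \mathrel{\mathcal{D}} b$ iff there exists $c \in M$ with $a \mathrel{\mathcal{R}} c$ and $c \mathrel{\mathcal{L}} b$. *)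

(* Defs.v *)
From HB Require Import structures.
From mathcomp Require Import all_boot all_order all_algebra.
From mathcomp Require Import all_classical all_reals.

Set Implicit Arguments.
Unset Strict Implicit.
Unset Printing Implicit Defensive.

Import Order.TTheory GRing.Theory Num.Theory.

Local Open Scope classical_set_scope.
Local Open Scope ring_scope.

Section Green.
Variable S : semigroupType.

Definition has_identity : Prop :=
  exists e : S, forall x : S, (e * x)%g = x /\ (x * e)%g = x.

(* [option S] is S with an identity [None] always adjoined; the carrier
   [monoid_completion] below contains [None] only when S is not a monoid, so
   that it is a copy of S when S is a monoid. *)
Definition mul1 (x y : option S) : option S :=
  match x, y with
  | None, _ => y
  | _, None => x
  | Some a, Some b => Some (a * b)%g
  end.

Definition monoid_completion : set (option S) :=
  [set x | x = None -> ~ has_identity].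

Definition right_ideal (a : S) : set (option S) :=
  [set mul1 (Some a) x | x in monoid_completion].

Definition left_ideal (a : S) : set (option S) :=
  [set mul1 x (Some a) | x in monoid_completion].

Definition twosided_ideal (a : S) : set (option S) :=
  [set mul1 (mul1 x (Some a)) y | x in monoid_completion
                                & y in monoid_completion].

Definition green_R (a b : S) : Prop := right_ideal a = right_ideal b.

Definition green_L (a b : S) : Prop := left_ideal a = left_ideal b.

Definition green_J (a b : S) : Prop := twosided_ideal a = twosided_ideal b.

Definition green_D (a b : S) : Prop :=
  exists c : S, green_R a c /\ green_L c b.

End Green.

(* A type of its own, so that its product is the tropical one and not the
   usual product of matrices over R. *)
Definition FTmx (R : realType) (n : nat) : Type := 'M[R]_n.

HB.instance Definition _ (R : realType) (n : nat) :=
  Choice.copy (FTmx R n) 'M[R]_n.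

(* There is no tropical zero in R: the default value of the iterated maximum is
   its own term k = i, so that this is the maximum of the terms over all k. *)
Definition FTmulmx (R : realType) (n : nat) (A B : FTmx R n) : FTmx R n :=
  \matrix_(i < n, j < n)
    \big[Num.max/(A : 'M[R]_n) i i + (B : 'M[R]_n) i j]_(k < n)
      ((A : 'M[R]_n) i k + (B : 'M[R]_n) k j).

Lemma FTmulmx_leP (R : realType) (n : nat) (A B : FTmx R n) (i j : 'I_n)
    (m : R) :
  reflect (forall k, (A : 'M[R]_n) i k + (B : 'M[R]_n) k j <= m)
          ((FTmulmx A B : 'M[R]_n) i j <= m).
Proof.
rewrite mxE; apply: (iffP (bigmax_leP _ _ _ _)) => [[_ h] k|h]; first exact: h.
by split=> [|k _]; exact: h.
Qed.

Lemma FTmulmxA (R : realType) (n : nat) : associative (@FTmulmx R n).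
Proof.
move=> A B C; apply/matrixP => i j; apply/le_anti/andP; split.
- apply/FTmulmx_leP => k; rewrite -lerBrDl; apply/FTmulmx_leP => l.
  rewrite lerBrDl addrA.
  have /FTmulmx_leP/(_ l) := lexx ((FTmulmx (FTmulmx A B) C : 'M[R]_n) i j).
  apply: le_trans; rewrite lerD2r.
  by have /FTmulmx_leP/(_ k) := lexx ((FTmulmx A B : 'M[R]_n) i l).
- apply/FTmulmx_leP => k; rewrite -lerBrDr; apply/FTmulmx_leP => l.
  rewrite lerBrDr -addrA.
  have /FTmulmx_leP/(_ l) := lexx ((FTmulmx A (FTmulmx B C) : 'M[R]_n) i j).
  apply: le_trans; rewrite lerD2l.
  by have /FTmulmx_leP/(_ k) := lexx ((FTmulmx B C : 'M[R]_n) l j).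
Qed.

HB.instance Definition _ (R : realType) (n : nat) :=
  isSemigroup.Build (FTmx R n) (@FTmulmxA R n).

(* Main.v *)
Require Import Defs.
From mathcomp Require Import all_boot all_order all_algebra.
From mathcomp Require Import all_classical all_reals.
From mathcomp Require Import lra.

(** D is contained in J in every semigroup. Conversely, if A J B, say B = X A Y
    and A = P B Q, then A = U A V with U = P X and V = Y Q. Everything rests on
    the stability of tropical matrices: A = U A V implies A = W (U A) for some
    W, and dually on the right ([FTmx_stable]). Indeed W P then undoes the
    multiplication by X, so A and X A generate the same left ideal; dually A and
    A Y generate the same right ideal; and A Y links A to B = X A Y, as in the
    proof for finite semigroups ([stable_green_J_D]).

    Stability is a recurrence argument. Clearly A = U^k A V^k for all k. Since
    all entries of U are finite, each U^k has its entries within a distance of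
    each other that does not depend on k, so that, up to adding scalars, the
    powers of U stay in a bounded box and the pigeonhole principle gives p < q
    with U^q within e of c + U^p ([powS_almost_recurrent]). Multiplication by a
    tropical matrix does not expand sup-distances, hence
    U^(q-p) A = U^q A V^p is within e of c + U^p A V^p = c + A, which makes A
    a left multiple of U A up to e. Finally e is removed by residuation: among
    the W with W (U A) <= A there is a greatest one, the residual, which lies
    above every approximate solution lowered by its error, so it is an exact
    solution ([left_divisible_closed]). *)

Set Implicit Arguments.
Unset Strict Implicit.
Unset Printing Implicit Defensive.

Import Order.TTheory GRing.Theory Num.Theory.

Local Open Scope classical_set_scope.
Local Open Scope ring_scope.

(** * Green's relations in terms of multipliers *)

Section Semigroup.
Variable S : semigroupType.
Implicit Types (a b c : S) (x y z : option S).

Local Notation "x ** y" := (mul1 x y) (at level 40, left associativity).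

Lemma mul1A x y z : x ** (y ** z) = x ** y ** z.
Proof. by case: x y z => [a|] [b|] [c|] //=; rewrite mulgA. Qed.

Lemma mul1_Some_r a x : exists b, Some a ** x = Some b.
Proof. by case: x => [c|]; eexists. Qed.

Lemma mul1_Some_l a x : exists b, x ** Some a = Some b.
Proof. by case: x => [c|]; eexists. Qed.

(** When S already has an identity e, the formal identity is not in the
    completion, but e acts in the same way on S. This is what allows the
    multipliers below to range over all of [option S]. *)
Lemma completion_multiplier x : exists2 x', monoid_completion x' &
  forall a, x ** Some a = x' ** Some a /\ Some a ** x = Some a ** x'.
Proof.
case: x => [b|]; first by exists (Some b).
have [[e He]|noid] := pselect (has_identity S); last by exists None.
by exists (Some e) => // a; have [/= -> ->] := He a.
Qed.

Lemma completion_None_or_id : exists2 x, monoid_completion x &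
  forall a, x ** Some a = Some a /\ Some a ** x = Some a.
Proof.
have [x Mx Hx] := completion_multiplier None.
by exists x => // a; have [<- <-] := Hx a.
Qed.

Lemma green_RP a b : green_R a b <->
  (exists x, Some a = Some b ** x) /\ (exists x, Some b = Some a ** x).
Proof.
have sub c d : right_ideal c `<=` right_ideal d <->
    exists x, Some c = Some d ** x.
  split=> [/(_ (Some c)) cd|[x Ec] _ [y My <-]].
    have [|x _ <-] := cd; last by exists x.
    by have [x Mx Hx] := completion_None_or_id; exists x => //; case: (Hx c).
  have [z Mz Hz] := completion_multiplier (x ** y).
  by exists z => //; rewrite Ec -mul1A; case: (Hz d).
by rewrite -!sub; split=> [->|[ab ba]]; [split | rewrite /green_R eqEsubset].
Qed.

Lemma green_LP a b : green_L a b <->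
  (exists x, Some a = x ** Some b) /\ (exists x, Some b = x ** Some a).
Proof.
have sub c d : left_ideal c `<=` left_ideal d <->
    exists x, Some c = x ** Some d.
  split=> [/(_ (Some c)) cd|[x Ec] _ [y My <-]].
    have [|x _ <-] := cd; last by exists x.
    by have [x Mx Hx] := completion_None_or_id; exists x => //; case: (Hx c).
  have [z Mz Hz] := completion_multiplier (y ** x).
  by exists z => //; rewrite Ec mul1A; case: (Hz d).
by rewrite -!sub; split=> [->|[ab ba]]; [split | rewrite /green_L eqEsubset].
Qed.

Lemma green_JP a b : green_J a b <->
  (exists x y, Some a = x ** Some b ** y) /\
  (exists x y, Some b = x ** Some a ** y).
Proof.
have sub c d : twosided_ideal c `<=` twosided_ideal d <->
    exists x y, Some c = x ** Some d ** y.
  split=> [/(_ (Some c)) cd|[x [y Ec]] _ [u Mu [v Mv <-]]].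
    have [|x _ [y _ <-]] := cd; last by exists x, y.
    have [x Mx Hx] := completion_None_or_id.
    by exists x => //; exists x => //; have [-> ->] := Hx c.
  have [z Mz Hz] := completion_multiplier (u ** x).
  have [w Mw Hw] := completion_multiplier (y ** v).
  exists z => //; exists w => //.
  have [<- _] := Hz d; have [e Ee] := mul1_Some_l d (u ** x).
  by rewrite Ee -(Hw e).2 -Ee Ec !mul1A.
by rewrite -!sub; split=> [->|[ab ba]]; [split | rewrite /green_J eqEsubset].
Qed.

Lemma green_D_J a b : green_D a b -> green_J a b.
Proof.
case=> c [/green_RP[[x Ea] [y Ec]] /green_LP[[z Ec'] [w Eb]]].
apply/green_JP; split; first by exists z, x; rewrite -Ec'.
by exists w, y; rewrite -mul1A -Ec.
Qed.

(** Finite and compact semigroups have this property, in the usual form that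
    a J u a implies a L u a and a J a v implies a R a v. *)
Definition stable_semigroup := forall a u v : S, (u * a * v)%g = a ->
  (exists w, w * (u * a) = a)%g /\ (exists w, (a * v) * w = a)%g.

Lemma stable_mul1 : stable_semigroup ->
  forall a x y, x ** Some a ** y = Some a ->
  (exists z, z ** (x ** Some a) = Some a) /\
  (exists z, (Some a ** y) ** z = Some a).
Proof.
move=> st a [u|] [v|] /= E.
- case: E => /st[[w Ew] [w' Ew']].
  by split; [exists (Some w); rewrite /= Ew | exists (Some w'); rewrite /= Ew'].
- by split; exists None.
- by split; exists None.
- by split; exists None.
Qed.

(** If a = p b q and b = x a y, then a = (p x) a (y q), so that stability makes
    both p x on the left and y q on the right invertible on a. Hence a and
    a y generate the same right ideal, while b = x (a y) and
    a y generate the same left ideal. *)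
Lemma stable_green_J_D : stable_semigroup ->
  forall a b, green_J a b -> green_D a b.
Proof.
move=> st a b /green_JP[[p [q Ea]] [x [y Eb]]].
have Eaa : (p ** x) ** Some a ** (y ** q) = Some a by rewrite {2}Ea Eb !mul1A.
have [[z Ez] [t Et]] := stable_mul1 st Eaa.
have [c Ec] := mul1_Some_r a y.
exists c; split.
  apply/green_RP; split; last by exists y.
  by exists (q ** t); rewrite -Ec -{1}Et !mul1A.
apply/green_LP; split; last by exists x; rewrite -Ec mul1A.
by exists (z ** p); rewrite -Ec -{1}Ez Eb !mul1A.
Qed.

End Semigroup.

(** * Almost-recurrence of bounded sequences *)

(** Pigeonhole on the cells of a grid of mesh e. *)
Lemma bounded_almost_recurrent (R : realType) (T : finType)
    (Y : nat -> T -> R) (M e : R) :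
  0 < e -> (forall k t, `|Y k t| <= M) ->
  exists k l, (k < l)%N /\ forall t, `|Y k t - Y l t| <= e.
Proof.
move=> e0 YM.
pose cell k t := Num.trunc ((Y k t + M) / e).
have pos k t : 0 <= (Y k t + M) / e.
  apply: divr_ge0; last exact: ltW.
  by have := YM k t; rewrite ler_norml => /andP[]; lra.
pose N := Num.trunc ((M + M) / e).
have cellN k t : (cell k t < N.+1)%N.
  rewrite ltnS; apply: le_truncn; rewrite ler_pM2r ?invr_gt0 // lerD2r.
  by have := YM k t; rewrite ler_norml => /andP[].
pose f k : {ffun T -> 'I_N.+1} := [ffun t => Ordinal (cellN k t)].
have /injectivePn[k [l kl fkl]] :
    ~~ injectiveb (fun k : 'I_(#|{ffun T -> 'I_N.+1}|.+1) => f k).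
  by apply/negP => /injectiveP /leq_card; rewrite card_ord ltnn.
have close t : `|Y k t - Y l t| <= e.
  have E : cell k t = cell l t.
    have := congr1 (fun g : {ffun T -> 'I_N.+1} => val (g t)) fkl.
    by rewrite !ffunE.
  have /andP[k1 k2] := truncn_itv (pos k t).
  have /andP[l1 l2] := truncn_itv (pos l t).
  rewrite -/(cell k t) E in k1 k2; rewrite -/(cell l t) in l1 l2.
  rewrite ler_pdivlMr // in k1; rewrite ltr_pdivrMr // in k2.
  rewrite ler_pdivlMr // in l1; rewrite ltr_pdivrMr // in l2.
  rewrite -natr1 mulrDl mul1r in k2 l2.
  by rewrite ler_norml; apply/andP; split; lra.
case: (ltngtP k l) => [lkl|llk|/val_inj Ekl]; last by rewrite Ekl eqxx in kl.
  by exists k, l.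
by exists l, k; split=> // t; rewrite distrC.
Qed.

(** * The tropical matrix semigroup is stable *)

Section Tropical.
Variables (R : realType) (n : nat).
Implicit Types (A B U V W X Y : FTmx R n) (c e s : R).

Lemma FTmul_leP X Y i j (m : R) :
  reflect (forall k, X i k + Y k j <= m) ((X * Y)%g i j <= m).
Proof. exact: FTmulmx_leP. Qed.

Lemma FTmul_ge X Y i k j : X i k + Y k j <= (X * Y)%g i j.
Proof. exact: (elimT (FTmul_leP X Y i j _) (lexx _)). Qed.

(** The one property of the product on which all the estimates rest: it is
    monotone and commutes with adding a constant. *)
Lemma FTmul_le X Y X' Y' i j i' j' c :
  (forall k, X i k + Y k j <= X' i' k + Y' k j' + c) ->
  (X * Y)%g i j <= (X' * Y')%g i' j' + c.
Proof.
move=> h; apply/FTmul_leP => k; apply: (le_trans (h k)).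
by rewrite lerD2r FTmul_ge.
Qed.

Lemma FTmx_le_anti X Y :
  (forall i j, X i j <= Y i j) -> (forall i j, Y i j <= X i j) -> X = Y.
Proof. by move=> XY YX; apply/matrixP => i j; apply/le_anti; rewrite XY YX. Qed.

Definition FTtr X : FTmx R n := (X : 'M[R]_n)^T.

Lemma FTtrE X i j : FTtr X i j = X j i.
Proof. exact: mxE. Qed.

Lemma FTtrK : involutive FTtr.
Proof. exact: trmxK. Qed.

Lemma FTtr_mul X Y : FTtr (X * Y)%g = (FTtr Y * FTtr X)%g.
Proof.
apply: FTmx_le_anti => i j; rewrite FTtrE.
  apply/FTmul_leP => k; rewrite addrC -(FTtrE X) -(FTtrE Y).
  exact: FTmul_ge.
by apply/FTmul_leP => k; rewrite !FTtrE addrC FTmul_ge.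
Qed.

(** Tropically W Y <= A means W i j <= A i k - Y j k for all k. As for the
    product, the default of the iterated minimum is its term k = i. *)
Definition residual A Y : FTmx R n :=
  \matrix_(i < n, j < n)
    \big[Num.min/A i i - Y j i]_(k < n) (A i k - Y j k).

Lemma residual_geP A Y i j m :
  (forall k, m + Y j k <= A i k) <-> m <= residual A Y i j.
Proof.
rewrite mxE; split=> [h|/bigmin_geP[_ h] k]; last by rewrite -lerBrDr h.
by apply/bigmin_geP; split=> [|k _]; rewrite lerBrDr.
Qed.

(** The residual is the greatest W with W Y <= A. An approximate solution,
    lowered by its error, is below the residual, whose product with Y is
    therefore as close to A as one likes. *)
Lemma left_divisible_closed A Y :
  (forall e, 0 < e -> exists W, forall i j, `|(W * Y)%g i j - A i j| <= e) ->
  exists W, (W * Y)%g = A.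
Proof.
move=> h; exists (residual A Y); apply: FTmx_le_anti => i j.
  by apply/FTmul_leP => k; apply: (residual_geP A Y i k _).2.
apply/ler_addgt0Pr => e e0.
have [W HW] := h (e / 2) (divr_gt0 e0 (ltr0n _ 2)).
have bnd i' j' : (W * Y)%g i' j' <= A i' j' + e / 2 /\
                 A i' j' <= (W * Y)%g i' j' + e / 2.
  by have := HW i' j'; rewrite ler_norml => /andP[]; split; lra.
have WR k : W i k - e / 2 <= residual A Y i k.
  by apply/residual_geP => l; have := FTmul_ge W Y i k l;
    have [] := bnd i l; lra.
have [_ le1] := bnd i j.
have le2 : (W * Y)%g i j <= (residual A Y * Y)%g i j + e / 2.
  by apply: FTmul_le => k; have := WR k; lra.
lra.
Qed.

(** The k-th term is the power k + 1: when n > 1 there is no identity matrix to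
    start from, as its off-diagonal entries would have to be infinite. *)
Definition powS U k : FTmx R n := iter k (fun X => X * U)%g U.

Lemma powSS U k : powS U k.+1 = (powS U k * U)%g.
Proof. by []. Qed.

Lemma powS_add U m k : powS U (m + k).+1 = (powS U m * powS U k)%g.
Proof.
elim: k => [|k IHk]; first by rewrite addn0.
by rewrite addnS powSS IHk powSS mulgA.
Qed.

Lemma powS_sandwich A U V k : (U * A * V)%g = A ->
  (powS U k * A * powS V k)%g = A.
Proof.
move=> E; elim: k => [//|k IHk].
rewrite powSS -[k in powS V k.+1]add0n powS_add.
by rewrite -[in RHS]IHk -[in RHS]E !mulgA.
Qed.

(** The variation of a product across rows is controlled by its left factor
    alone, and across columns by its right factor alone; so the variation of the
    powers of U is bounded in terms of that of U. *)
Lemma powS_variation U : exists s, forall k i j i' j',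
  `|powS U k i j - powS U k i' j'| <= s.
Proof.
pose m := \big[Num.max/0]_(p : 'I_n * 'I_n) `|U p.1 p.2|.
have Um i j : - m <= U i j <= m.
  by rewrite -ler_norml; apply: (le_bigmax _ (fun p => `|U p.1 p.2|) (i, j)).
have rows k i i' j : powS U k i j <= powS U k i' j + (m + m).
  elim: k i i' j => [|k IHk] i i' j; last first.
    by apply: FTmul_le => l; have := IHk i i' l; lra.
  by rewrite /=; have /andP[] := Um i j; have /andP[] := Um i' j; lra.
have cols k i j j' : powS U k i j <= powS U k i j' + (m + m).
  case: k => [|k].
    by rewrite /=; have /andP[] := Um i j; have /andP[] := Um i j'; lra.
  apply: FTmul_le => l.
  by have /andP[] := Um l j; have /andP[] := Um l j'; lra.
exists (m + m + (m + m)) => k i j i' j'; rewrite ler_norml; apply/andP; split.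
  by have := rows k i' i j'; have := cols k i j' j; lra.
by have := rows k i i' j; have := cols k i' j j'; lra.
Qed.

(** Subtracting one fixed entry from each power normalises it into a bounded
    set; c is the difference of the two normalising entries. *)
Lemma powS_almost_recurrent U e : 0 < e -> exists k l c, (k < l)%N /\
  forall i j, `|powS U l.*2 i j - (powS U k.*2 i j + c)| <= e.
Proof.
move=> e0; have [[i0 _]|noI] := pselect (exists i : 'I_n, True); last first.
  exists 0%N, 1%N, 0; split=> // i; by case: noI; exists i.
have [s Hs] := powS_variation U.
pose Y k (p : 'I_n * 'I_n) := powS U k.*2 p.1 p.2 - powS U k.*2 i0 i0.
have [k [l [kl H]]] := @bounded_almost_recurrent R _ Y s e e0
  (fun k p => Hs k.*2 p.1 p.2 i0 i0).
exists k, l, (powS U l.*2 i0 i0 - powS U k.*2 i0 i0); split=> // i j.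
rewrite distrC; congr (`|_| <= e) : (H (i, j)); rewrite /Y /=; lra.
Qed.

(** If U^q is nearly c + U^p with p < q, then U^(q-p) A = U^(q-p) U^p A V^p =
    U^q A V^p is nearly c + U^p A V^p = c + A, so that the matrix
    U^(q-p-1) - c multiplies U A nearly to A. *)
Lemma FTmx_left_stable A U V : (U * A * V)%g = A ->
  exists W, (W * (U * A))%g = A.
Proof.
move=> E; apply: left_divisible_closed => e e0.
have [k [l [c [kl H]]]] := powS_almost_recurrent U e0.
have [d Ed] : exists d, l.*2 = (d.+1 + k.*2).+1.
  (* Doubling the exponents makes them differ by at least 2, so that a factor U
     can be split off and what remains is still a genuine power of U. *)
  exists (l - k.+1).*2.
  by rewrite -{1}(subnK kl) doubleD doubleS !addnS addSn.
exists (\matrix_(i, j) (powS U d i j - c)).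
have EA : A = (powS U k.*2 * (A * powS V k.*2))%g.
  by rewrite mulgA powS_sandwich.
have ED : (powS U d * (U * A))%g = (powS U l.*2 * (A * powS V k.*2))%g.
  by rewrite Ed powS_add -mulgA -EA /= !mulgA.
move=> i j.
have H' i' j' : powS U l.*2 i' j' <= powS U k.*2 i' j' + c + e /\
                powS U k.*2 i' j' + c <= powS U l.*2 i' j' + e.
  by have := H i' j'; rewrite ler_norml => /andP[]; split; lra.
have hi : (powS U d * (U * A))%g i j <= A i j + (c + e).
  by rewrite ED [in leRHS]EA; apply: FTmul_le => m; have [] := H' i m; lra.
have lo : A i j <= (powS U d * (U * A))%g i j + (e - c).
  by rewrite ED [in leLHS]EA; apply: FTmul_le => m; have [] := H' i m; lra.
set W : FTmx R n := \matrix_(i, j) _.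
have WE i' j' : W i' j' = powS U d i' j' - c by exact: mxE.
have hi' : (W * (U * A))%g i j <= (powS U d * (U * A))%g i j + (- c).
  by apply: FTmul_le => m; rewrite WE; lra.
have lo' : (powS U d * (U * A))%g i j <= (W * (U * A))%g i j + c.
  by apply: FTmul_le => m; rewrite WE; lra.
by rewrite ler_norml; apply/andP; split; lra.
Qed.

Lemma FTmx_stable : stable_semigroup (FTmx R n).
Proof.
move=> A U V E; split; first exact: FTmx_left_stable E.
have Et : (FTtr V * FTtr A * FTtr U)%g = FTtr A.
  by rewrite -!FTtr_mul mulgA E.
have [W HW] := FTmx_left_stable Et.
by exists (FTtr W); apply: (can_inj FTtrK); rewrite !FTtr_mul FTtrK.
Qed.

End Tropical.

Theorem theorem6p1 (R : realType) (n : nat) (A B : FTmx R n) :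
  green_J A B <-> green_D A B.
Proof.
by split; [exact: (stable_green_J_D (@FTmx_stable R n)) | exact: green_D_J].
Qed.
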